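(* Let $(\Sigma,\mathbb M)$ be a surface with marked points and non-empty boundary, and let $\tau$ be a valency $\geq3$-triangulation of $(\Sigma,\mathbb M)$, with associated quiver with potential $(Q(\tau),S(\tau))$ and associated graph $G(\tau)$ with set of grey vertices $\mathbb G$. The set of admissible cuts for $\tau$ is in bijection with the set of partial matchings $M$ on $G(\tau)$ for which there exists a subset $V_M\subseteq\mathbb G$ such that $M$ is a perfect matching on $G(\tau)\setminus V_M$.
   Context: A surface with marked points $(\Sigma,\mathbb M)$ is a compact connected oriented surface $\Sigma$ with a finite non-empty set $\mathbb M\subset\Sigma$ containing at least one point on each boundary component; points of $\mathbb M$ in the interior are called punctures. The closed sphere with at most three punctures, the once-punctured monogon and the unpunctured disc with at most three marked points are excluded. Arcs and ideal triangulations are as in Fomin–Shapiro–Thurston. The valency of a puncture is the number of arc-ends incident to it; a valency $\geq3$-triangulation is an ideal triangulation in which every puncture has valency at least $3$ (so there are no self-folded triangles). A triangle is internal if all three of its sides are arcs. The quiver $Q(\tau)$ has the arcs of $\tau$ as vertices and, for each triangle and each pair of its sides $i,j$ that are arcs with $j$ immediately following $i$ clockwise along the boundary of the triangle, one arrow $i\to j$, which sits at the angle of the triangle between $i$ and $j$; each triangle contains $0$, $1$ or $3$ arrows. An arrow is ''shared by'' a triangle and a puncture if it lies in the triangle at an angle whose vertex is that puncture. With fixed non-zero scalars $x_p\in\mathbb C$, the potential is $S(\tau)=\sum_\triangle S^\triangle+\sum_px_pS^p$, where $S^\triangle$ is the 3-cycle of arrows in the internal triangle $\triangle$ and $S^p$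 is the cycle formed by all arrows at the puncture $p$. An admissible cut for $\tau$ is a map $d:Q(\tau)_1\to\{0,1\}$ such that every cycle appearing in $S(\tau)$ has total degree $1$ and $d(a)=0$ for every arrow $a$ not appearing in $S(\tau)$. The graph $G(\tau)$ (multiple edges allowed). Vertices: the set $\mathbb W$ of white vertices is in bijection with the union of the set of internal triangles of $\tau$ and the set of triangles with one side being a boundary segment and one vertex being a puncture; the set $\mathbb B$ of black vertices is in bijection with the set of punctures; the set $\mathbb G$ of grey vertices is in bijection with the union of the set of internal triangles that share at least one point with the boundary and the set of triangles with one side being a boundary segment and one vertex being a puncture. Edges: (a) for every arrow $\alpha$ shared by a puncture and a triangle, an edge $E_\alpha$ connecting the corresponding black and white vertices; (b) for every arrow $\alpha$ in an internal triangle and not shared by a puncture, an edge $E_\alpha$ connecting the grey and white vertices corresponding to this triangle; (c) for every triangle containing exactly one arrow $\alpha$, if $\alpha$ is shared by this triangle and a puncture, an edge $F_\alpha$ connecting the white and grey vertices corresponding to this triangle; and no other edges. A partial matching is a set of edges no two of which share a vertex; it is a perfect matching on a graph if every vertex of the graph belongs to one of its edges. $G(\tau)\setminus V_M$ is the graph obtained by removing the vertices in $V_M$ and all edges incident to them. *)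

(* Defs.v *)
From mathcomp Require Import all_boot all_algebra.

Set Implicit Arguments.
Unset Strict Implicit.
Unset Printing Implicit Defensive.

Import GRing.Theory.
Local Open Scope ring_scope.

(** * Ideal triangulations of surfaces with marked points

    A surface with marked points together with an ideal triangulation is given
    by its combinatorial (gluing) data: finitely many oriented triangles whose
    sides are glued in pairs, reversing the orientation of the boundaries, so
    that the result is connected.  The sides of the triangle [t] are
    [(t, 0), (t, 1), (t, 2)] in clockwise order, each directed clockwise.  Two
    glued sides form an arc; a side that is not glued (a fixed point of [glue])
    is a boundary segment.  Glued sides may belong to the same triangle: gluing
    two sides of one triangle gives a self-folded triangle.

    The two adjacent sides [s] and [next s] of a triangle bound an angle, and
    this angle is also denoted by [s]: its vertex is the final point of the
    clockwise directed side [s]. *)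

Record triangulation := Triangulation {
  tri :> finType;
  glue : tri * 'I_3 -> tri * 'I_3;
  glueK : involutive glue;
  tri_gt0 : (0 < #|tri|)%N;
  tri_connected : forall t u : tri,
    connect (fun t' u' => [exists i, (glue (t', i)).1 == u']) t u }.

Section Surface.
Variable tau : triangulation.

Definition side : finType := (tau * 'I_3)%type.

Definition next (s : side) : side := (s.1, ordS s.2).

Definition is_arc (s : side) : bool := glue s != s.

Definition has_boundary : bool := [exists s : side, ~~ is_arc s].

(** [turn s] is the angle reached from the angle [s] by rotating about its
    vertex across the side [next s], when that side is an arc: the side glued
    to [next s] ends where [next s] starts, that is, where [s] ends. *)
Definition turn (s : side) : side := glue (next s).

Definition turns_to (s s' : side) : bool := is_arc (next s) && (s' == turn s).

(** A marked point is identified with the set of all angles at it. *)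
Definition point_of (s : side) : {set side} :=
  [set s' | connect (fun a b => turns_to a b || turns_to b a) s s'].

Definition marked_points : {set {set side}} := [set point_of s | s : side].

Definition on_boundary (p : {set side}) : bool :=
  [exists s in p, ~~ is_arc s || ~~ is_arc (next s)].

Definition punctures : {set {set side}} :=
  [set p in marked_points | ~~ on_boundary p].

Definition puncture : finType := {p : {set side} | p \in punctures}.

Definition segment_of (s : side) : {set side} := [set s; glue s].
Definition segments : {set {set side}} := [set segment_of s | s : side].
Definition arcs : {set {set side}} := [set segment_of s | s : side & is_arc s].

Definition euler_char : int :=
  #|marked_points|%:Z - #|segments|%:Z + #|tau|%:Z.

(** A connected oriented surface is a sphere iff it is closed with Euler
    characteristic 2, and a disc iff it has non-empty boundary and Euler
    characteristic 1. *)
Definition is_sphere : bool := ~~ has_boundary && (euler_char == 2).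
Definition is_disc : bool := has_boundary && (euler_char == 1).

Definition excluded_surface : bool :=
  [|| is_sphere && (#|punctures| <= 3)%N,
      [&& is_disc, #|punctures| == 1%N & #|marked_points :\: punctures| == 1%N]
    | [&& is_disc, #|punctures| == 0%N & (#|marked_points| <= 3)%N]].

(** The two ends of the arc [{s, glue s}] are the final points of the directed
    sides [s] and [glue s], so arc-ends are the same as sides that are arcs. *)
Definition valency (p : {set side}) : nat := #|[set s in p | is_arc s]|.

Definition valency_ge3 : bool := [forall p in punctures, (3 <= valency p)%N].

Definition internal (t : tau) : bool := [forall i, is_arc (t, i)].

Definition at_puncture (s : side) : bool := point_of s \in punctures.

Definition bd_punctured (t : tau) : bool :=
  [exists i, ~~ is_arc (t, i)] && [exists i, at_puncture (t, i)].

Definition meets_boundary (t : tau) : bool :=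
  [exists i, on_boundary (point_of (t, i))].

(** Arrows sit at the angles both of whose sides are arcs. *)
Definition is_arrow (s : side) : bool := is_arc s && is_arc (next s).

Definition arrow : finType := {s : side | is_arrow s}.

Definition tri_of (a : arrow) : tau := (val a).1.

Definition nb_arrows (t : tau) : nat := #|[set i | is_arrow (t, i)]|.

Lemma segment_of_arc s : is_arc s -> segment_of s \in arcs.
Proof. by move=> arc_s; apply/imsetP; exists s; rewrite ?inE. Qed.

Lemma turn_inj : injective turn.
Proof.
move=> [t i] [u j] /(can_inj (@glueK tau)) /=; rewrite /next /= => -[-> eq_ij].
congr (_, _); apply: (can_inj (@ordSK 3)).
exact: val_inj.
Qed.

Lemma point_of_refl s : s \in point_of s.
Proof. by rewrite inE connect0. Qed.

Lemma at_punctureE s : at_puncture s = ~~ on_boundary (point_of s).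
Proof. by rewrite /at_puncture inE imset_f. Qed.

Lemma at_puncture_arrow s : at_puncture s -> is_arrow s.
Proof.
rewrite at_punctureE => /existsPn/(_ s); rewrite point_of_refl /=.
by rewrite -negb_and negbK.
Qed.

Lemma next3 s : next (next (next s)) = s.
Proof.
by case: s => t [[|[|[|k]]] ki] //; rewrite /next /=; congr (_, _); apply: val_inj.
Qed.

Record quiver := Quiver {
  qvertex : finType;
  qarrow : finType;
  qsrc : qarrow -> qvertex;
  qtgt : qarrow -> qvertex }.

Definition oriented_cycle (Q : quiver) (w : seq (qarrow Q)) : bool :=
  (w != [::]) && cycle (fun a b => qtgt a == qsrc b) w.

(** A potential is given by its coefficient at every cyclic word in the arrows;
    a cycle is represented by each of its rotations. *)
Definition potential (C : Type) (Q : quiver) := seq (qarrow Q) -> C.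

Definition appears_in (C : nzRingType) (Q : quiver) (S : potential C Q)
  (w : seq (qarrow Q)) : Prop := S w != 0.

Definition admissible_cut (C : nzRingType) (Q : quiver) (S : potential C Q)
    (d : {ffun qarrow Q -> 'I_2}) : Prop :=
  (forall w, appears_in S w -> (\sum_(a <- w) d a)%N = 1%N) /\
  (forall a, (forall w, appears_in S w -> a \notin w) -> d a = ord0).

Definition arc_vertex : finType := {A : {set side} | A \in arcs}.

Definition src (a : arrow) : arc_vertex :=
  exist _ (segment_of (val a))
    (segment_of_arc (proj1 (andP (valP a)))).
Definition tgt (a : arrow) : arc_vertex :=
  exist _ (segment_of (next (val a)))
    (segment_of_arc (proj2 (andP (valP a)))).

Definition quiver_of : quiver := @Quiver arc_vertex arrow src tgt.

(** [w] is the 3-cycle formed by the arrows in [t], up to rotation. *)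
Definition is_tri_cycle (t : tau) (w : seq arrow) : bool :=
  [exists i, map val w == [:: (t, i); next (t, i); next (next (t, i))]].

(** [w] is the cycle formed by all the arrows at [p], up to rotation. *)
Definition is_puncture_cycle (p : puncture) (w : seq arrow) : bool :=
  [exists s in val p, map val w == orbit turn s].

Definition potential_of (C : nzRingType) (x : puncture -> C) :
    potential C quiver_of :=
  fun w => \sum_(t : tau | internal t) (is_tri_cycle t w)%:R
         + \sum_(p : puncture) x p * (is_puncture_cycle p w)%:R.

Lemma src_tgt (a b : arrow) :
  (val b == next (val a)) || (val b == turn (val a)) -> tgt a = src b.
Proof.
move=> h; apply: val_inj => /=; case/orP: h => /eqP -> //.
by rewrite /segment_of /turn glueK setUC.
Qed.

Lemma tri_cycle_oriented t w :
  is_tri_cycle t w -> @oriented_cycle quiver_of w.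
Proof.
case/existsP => i /eqP; case: w => [|a [|b [|c [|d w]]]] //= [ea eb ec].
have ab : tgt a = src b by apply: src_tgt; rewrite /= ea eb eqxx.
have bc : tgt b = src c by apply: src_tgt; rewrite /= eb ec eqxx.
have ca : tgt c = src a by apply: src_tgt; rewrite /= ec ea next3 eqxx.
by rewrite /oriented_cycle /= ab bc ca !eqxx.
Qed.

Lemma puncture_cycle_oriented p w :
  is_puncture_cycle p w -> @oriented_cycle quiver_of w.
Proof.
case/existsP => s /andP[_ /eqP ew]; apply/andP; split.
  by case: w ew => // /(congr1 size); rewrite size_orbit => /esym/eqP;
     rewrite -leqn0 leqNgt order_gt0.
have: fcycle turn (map val w) by rewrite ew; apply: (cycle_orbit turn_inj).
rewrite cycle_map; apply: sub_cycle => a b /= /eqP e.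
by apply/eqP; apply: src_tgt; rewrite e eqxx orbT.
Qed.

Lemma potential_of_supp (C : nzRingType) (x : puncture -> C) w :
  appears_in (potential_of x) w -> oriented_cycle w.
Proof.
move=> Sw; have [[t tw]|/existsPn/= not_tri] := altP (@existsP _ (is_tri_cycle^~ w)).
  exact: tri_cycle_oriented tw.
have [[p pw]|/existsPn/= not_p] := altP (@existsP _ (is_puncture_cycle^~ w)).
  exact: puncture_cycle_oriented pw.
move: Sw; rewrite /appears_in /potential_of !big1 ?addr0 ?eqxx // => i _.
  by rewrite (negPf (not_p i)) mulr0.
by rewrite (negPf (not_tri i)).
Qed.

Definition is_white (t : tau) : bool := internal t || bd_punctured t.
Definition is_grey (t : tau) : bool :=
  internal t && meets_boundary t || bd_punctured t.

Definition white : finType := {t : tau | is_white t}.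
Definition black : finType := puncture.
Definition grey : finType := {t : tau | is_grey t}.

Definition vertex : finType := (white + black + grey)%type.
Definition White (v : white) : vertex := inl (inl v).
Definition Black (v : black) : vertex := inl (inr v).
Definition Grey (v : grey) : vertex := inr v.

Definition type_a (a : arrow) : bool := at_puncture (val a).
Definition type_b (a : arrow) : bool :=
  internal (tri_of a) && ~~ at_puncture (val a).
Definition type_c (a : arrow) : bool :=
  (nb_arrows (tri_of a) == 1%N) && at_puncture (val a).

(** The edges of type (a), (b) are the [E_a]; those of type (c) the [F_a]. *)
Definition edge : finType :=
  ({a : arrow | type_a a} + {a : arrow | type_b a} + {a : arrow | type_c a})%type.

Lemma arrow_boundary (a : arrow) :
  at_puncture (val a) -> ~~ internal (tri_of a) -> bd_punctured (tri_of a).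
Proof.
move=> pa nint; apply/andP; split; first by rewrite -negb_forall.
by apply/existsP; exists (val a).2; rewrite /tri_of -surjective_pairing.
Qed.

Lemma white_a (a : arrow) : type_a a -> is_white (tri_of a).
Proof.
by rewrite /is_white; case: (boolP (internal _)) => //= nint /arrow_boundary ->.
Qed.

Lemma white_b (a : arrow) : type_b a -> is_white (tri_of a).
Proof. by case/andP => int_a _; rewrite /is_white int_a. Qed.

Lemma grey_b (a : arrow) : type_b a -> is_grey (tri_of a).
Proof.
case/andP => int_a; rewrite at_punctureE negbK => bd.
rewrite /is_grey int_a; apply/orP; left; apply/existsP.
by exists (val a).2; rewrite /tri_of -surjective_pairing.
Qed.

Lemma bd_c (a : arrow) : type_c a -> bd_punctured (tri_of a).
Proof.
case/andP => n1 pa; apply: arrow_boundary => //.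
apply: contraL n1 => /forallP int_a; rewrite /nb_arrows.
rewrite (_ : [set i | _] = setT) ?cardsT ?card_ord //.
by apply/setP => i; rewrite !inE /is_arrow !int_a.
Qed.

Lemma white_c (a : arrow) : type_c a -> is_white (tri_of a).
Proof. by move/bd_c => bd; rewrite /is_white bd orbT. Qed.

Lemma grey_c (a : arrow) : type_c a -> is_grey (tri_of a).
Proof. by move/bd_c => bd; rewrite /is_grey bd orbT. Qed.

Record multigraph := Multigraph {
  gvertex : finType;
  gedge : finType;
  gends : gedge -> {set gvertex} }.

Definition ends (e : edge) : {set vertex} :=
  match e with
  | inl (inl a) => [set Black (exist _ (point_of (val (val a))) (valP a));
                        White (exist _ (tri_of (val a)) (white_a (valP a)))]
  | inl (inr a) => [set Grey (exist _ (tri_of (val a)) (grey_b (valP a)));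
                        White (exist _ (tri_of (val a)) (white_b (valP a)))]
  | inr a => [set White (exist _ (tri_of (val a)) (white_c (valP a)));
                  Grey (exist _ (tri_of (val a)) (grey_c (valP a)))]
  end.

Definition graph_of : multigraph := @Multigraph vertex edge ends.

Definition grey_vertices : {set gvertex graph_of} := [set Grey v | v : grey].

End Surface.

Definition partial_matching (G : multigraph) (M : {set gedge G}) : Prop :=
  {in M &, forall e f, e != f -> [disjoint gends e & gends f]}.

(** [M] is a perfect matching on the graph obtained from [G] by removing the
    vertices in [V] and all edges incident to them. *)
Definition perfect_matching_off (G : multigraph) (V : {set gvertex G})
    (M : {set gedge G}) : Prop :=
  [/\ {in M, forall e, [disjoint gends e & V]},
      partial_matching M
    & forall v, v \notin V -> exists2 e, e \in M & v \in gends e].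

(* Main.v *)
Require Import Defs.
From mathcomp Require Import all_boot all_order all_algebra.
From mathcomp Require Import classical_sets functions reals.
From mathcomp Require Import complex.

(** Since no cycle is both a triangle cycle and a puncture cycle, nothing
    cancels in the potential, so an admissible cut is a choice of exactly one
    arrow of degree 1 in each internal triangle and at each puncture, all arrows
    outside these having degree 0.  Send a cut [d] to the edges [E_a] with
    [d a = 1] and the edges [F_a] with [d a = 0].  A triangle with a boundary
    segment and an angle at a puncture has this single arrow [a], and its white
    vertex has only the edges [E_a] and [F_a], so it is covered exactly once;
    the other white and the black vertices are covered exactly once by the cut
    condition.  A grey vertex is adjacent only to the white vertex of its own
    triangle, so it imposes no further condition. *)

Set Implicit Arguments.
Unset Strict Implicit.
Unset Printing Implicit Defensive.

Local Open Scope ring_scope.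
Import GRing.Theory.

(** Degrees are 0 or 1, so the sum counts the entries of non-zero degree. The right-hand side states
    uniqueness as a boolean equation, ready for rewriting membership in a matching. *)
Lemma sum_binary_eq1 (T : eqType) (d : T -> 'I_2) (w : seq T) : uniq w ->
  (\sum_(a <- w) d a = 1)%N <->
  exists2 a, a \in w & {in w, forall b, (d b != ord0) = (b == a)}.
Proof.
move=> uw.
have -> : (\sum_(a <- w) d a)%N = size [seq a <- w | d a != ord0].
  rewrite size_filter -sum1_count [RHS]big_mkcond; apply: eq_bigr => a _.
  by case: (d a) => [[|[|k]] lt_k].
split=> [/eqP|[a aw da]].
  case def_w: (filter _ w) => [|a [|]] // _.
  have mem_w b : (b \in w) && (d b != ord0) = (b == a).
    by rewrite andbC -[RHS]mem_seq1 -def_w mem_filter.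
  exists a => [|b bw]; last by rewrite -mem_w bw.
  by have /andP[] : (a \in w) && (d a != ord0) by rewrite mem_w.
by rewrite (eq_in_filter da) filter_pred1_uniq.
Qed.

(** * Punctures as orbits of the rotation, and the cycles of the potential *)

Section Triangulation.
Variable tau : triangulation.
Implicit Types (s : side tau) (a b : arrow tau) (w : seq (arrow tau)).

Lemma point_of_eq s s' : s' \in point_of s -> point_of s' = point_of s.
Proof.
rewrite inE => ss'; apply/setP => u; rewrite !inE.
have sym : connect_sym (fun a b : side tau => turns_to a b || turns_to b a).
  by apply: sym_connect_sym => a b; rewrite orbC.
by rewrite (same_connect sym ss').
Qed.

Lemma punctureP (p : puncture tau) s : (s \in val p) = (point_of s == val p).
Proof.
case: p => p /=; rewrite inE => /andP[/imsetP[s0 _ ->] _].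
apply/idP/eqP => [/point_of_eq //|<-]; exact: point_of_refl.
Qed.

Lemma at_puncture_point_of s s' :
  point_of s = point_of s' -> at_puncture s = at_puncture s'.
Proof. by rewrite /at_puncture => ->. Qed.

(** Around a puncture each side met by the rotation is an arc, so [turn] never leaves the point; the
    connected class is then a full [turn]-orbit. *)
Lemma point_of_orbit s s' : at_puncture s ->
  (s' \in orbit (@turn tau) s) = (point_of s' == point_of s).
Proof.
move=> ps; rewrite -fconnect_orbit; apply/idP/eqP => [|eq_ss'].
  move/iter_findex <-; elim: (findex _ _ _) => //= n <-.
  apply: point_of_eq; rewrite inE; apply: connect1.
  have : at_puncture (iter n (@turn tau) s).
    elim: n => //= n pn; rewrite (at_puncture_point_of (s' := iter n (@turn tau) s)) //.
    apply: point_of_eq; rewrite inE; apply: connect1.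
    by have /andP[_ arc_n] := at_puncture_arrow pn; rewrite /turns_to arc_n eqxx.
  by move/at_puncture_arrow => /andP[_ arc_n]; rewrite /turns_to arc_n eqxx.
have : s' \in point_of s by rewrite -eq_ss' point_of_refl.
(* Backward turns also stay in the orbit, because [turn] is injective on a finite type. *)
rewrite inE; apply: connect_sub => a b; case/orP=> /andP[_ /eqP->].
  exact: fconnect1.
by rewrite (fconnect_sym (@turn_inj tau)) fconnect1.
Qed.

Lemma map_val_arrow (l : seq (side tau)) :
  all (@is_arrow tau) l -> exists w, map val w = l.
Proof.
elim: l => [|s l IHl] /=; first by exists [::].
by case/andP=> arr_s /IHl[w <-]; exists (exist _ s arr_s :: w).
Qed.

Lemma puncture_cycle_mem (p : puncture tau) w : is_puncture_cycle p w ->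
  uniq w /\ forall a, (a \in w) = (point_of (val a) == val p).
Proof.
case/existsP=> s /andP[]; rewrite punctureP => /eqP ps /eqP ew; split.
  by rewrite -(map_inj_uniq val_inj) ew orbit_uniq.
move=> a; rewrite -(mem_map val_inj) ew point_of_orbit ?ps //.
by rewrite /at_puncture ps (valP p).
Qed.

Lemma puncture_cycle_exists (p : puncture tau) :
  exists w, is_puncture_cycle p w.
Proof.
have: val p \in punctures tau := valP p.
rewrite inE => /andP[/imsetP[s _ ep] _].
have ps : at_puncture s by rewrite /at_puncture -ep (valP p).
have [w ew] : exists w, map val w = orbit (@turn tau) s.
  apply: map_val_arrow; apply/allP => s'; rewrite point_of_orbit // => /eqP.
  by move/at_puncture_point_of; rewrite ps => /at_puncture_arrow.
by exists w; apply/existsP; exists s; rewrite ew eqxx punctureP ep eqxx.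
Qed.

Lemma tri_cycle_mem (t : tau) w : is_tri_cycle t w ->
  uniq w /\ forall a, (a \in w) = (tri_of a == t).
Proof.
case/existsP=> i /eqP ew; split.
  rewrite -(map_inj_uniq val_inj) ew /= !inE /Defs.next !xpair_eqE !eqxx /=.
  by case: i {ew} => [[|[|[|k]]] lt_k].
move=> a; rewrite -(mem_map val_inj) ew /tri_of; case: (val a) => u j /=.
rewrite !inE /Defs.next !xpair_eqE /= -!andb_orr andb_idr //= => _.
by case: i {ew} j => [[|[|[|k]]] lt_k] // [[|[|[|j]]] lt_j].
Qed.

Lemma tri_cycle_exists (t : tau) : internal t -> exists w, is_tri_cycle t w.
Proof.
move/forallP=> int_t.
have arrow_t i : is_arrow (t, i) by rewrite /is_arrow !int_t.
have [|w ew] := @map_val_arrow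
  [:: (t, ord0); Defs.next (t, ord0); Defs.next (Defs.next (t, ord0))].
  by rewrite /= /Defs.next /= !arrow_t.
by exists w; apply/existsP; exists ord0; rewrite ew.
Qed.

(** If the two cycles coincided, [turn] would agree with [next] at some angle of [t]. The following
    side would then be glued to itself, hence be a boundary segment, although an arrow sits next to
    it. *)
Lemma tri_puncture_cycle (t : tau) (p : puncture tau) w :
  is_tri_cycle t w -> ~~ is_puncture_cycle p w.
Proof.
case/existsP=> i /eqP ew; apply/negP => /existsP[s /andP[_ /eqP]].
rewrite ew => eo; have := cycle_orbit (@turn_inj tau) s; rewrite -eo /=.
case/andP=> /eqP glue_eq _; case: w ew {eo} => // a w [ea _].
by have /andP[_] := valP a; rewrite (ea : val a = _) /is_arc -/(turn _) glue_eq eqxx.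
Qed.

(** * Admissible cuts as choices of arrows *)

Section Potential.
Variables (C : nzRingType) (x : puncture tau -> C).
Hypothesis x_neq0 : forall p, x p != 0.

(** The coefficient is exactly 1: puncture terms vanish, and a second triangle would share the first
    arrow of [w]. *)
Lemma appears_tri_cycle (t : tau) w :
  internal t -> is_tri_cycle t w -> appears_in (potential_of x) w.
Proof.
move=> int_t tw; rewrite /appears_in /potential_of addrC big1 => [|p _]; last first.
  by rewrite (negPf (tri_puncture_cycle p tw)) mulr0.
rewrite add0r (bigD1 t) //= tw big1 ?addr0 ?oner_neq0 // => u /andP[_ neq_ut].
case: (boolP (is_tri_cycle u w)) => // uw; case/negP: neq_ut.
case/existsP: (tw) => i /eqP; case: w tw uw => // a w tw uw _.
have [_ /(_ a)] := tri_cycle_mem uw; have [_ /(_ a)] := tri_cycle_mem tw.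
by rewrite !inE eqxx => /esym/eqP-> /esym/eqP->.
Qed.

(** The coefficient is exactly [x p]: an arrow of [w] determines its puncture, so no other term
    contributes. *)
Lemma appears_puncture_cycle (p : puncture tau) w :
  is_puncture_cycle p w -> appears_in (potential_of x) w.
Proof.
move=> pw; rewrite /appears_in /potential_of big1 => [|t _]; last first.
  by case: (boolP (is_tri_cycle t w)) => // /(tri_puncture_cycle p); rewrite pw.
rewrite add0r (bigD1 p) //= pw mulr1 big1 ?addr0 // => q neq_qp.
case: (boolP (is_puncture_cycle q w)) => [qw|]; last by rewrite mulr0.
case/negP: neq_qp; have /andP[] := puncture_cycle_oriented pw.
case: w pw qw => // a w pw qw _ _.
have [_ /(_ a)] := puncture_cycle_mem qw; have [_ /(_ a)] := puncture_cycle_mem pw.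
rewrite mem_head => /esym/eqP ap /esym/eqP aq.
by apply/eqP/val_inj; rewrite -aq.
Qed.

Lemma appears_inP w : appears_in (potential_of x) w ->
  (exists2 t, internal t & is_tri_cycle t w) \/
  (exists p, is_puncture_cycle p w).
Proof.
have [/exists_inP|no_t] := boolP [exists t in @internal tau, is_tri_cycle t w].
  by left.
have [/existsP|no_p] := boolP [exists p, is_puncture_cycle p w]; first by right.
move=> Sw; case/negP: Sw.
rewrite /potential_of !big1 ?addr0 // => [p _|t int_t].
  by rewrite (negPf (existsPn no_p p)) mulr0.
by have /exists_inPn/(_ t int_t)/negPf-> := no_t.
Qed.

(** The arrows on some cycle of the potential are those of type (a) or (b): an arrow of an internal
    triangle has type (a) or (b) according to whether it is at a puncture. This replaces cyclic
    words by incidence conditions. *)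
Lemma admissible_cutP (d : {ffun arrow tau -> 'I_2}) :
  @admissible_cut C (quiver_of tau) (potential_of x) d <->
  [/\ forall t, internal t -> exists2 a, tri_of a = t &
        forall b, tri_of b = t -> (d b != ord0) = (b == a),
      forall p : puncture tau, exists2 a, point_of (val a) = val p &
        forall b, point_of (val b) = val p -> (d b != ord0) = (b == a)
    & forall a, ~~ type_a a -> ~~ type_b a -> d a = ord0].
Proof.
split=> [[sum1 d0]|[tri1 pun1 d0]].
  split=> [t int_t|p|a na nb].
  - have [w tw] := tri_cycle_exists int_t; have [uw mw] := tri_cycle_mem tw.
    have /(sum_binary_eq1 _ uw)[a] := sum1 w (appears_tri_cycle int_t tw).
    rewrite mw => /eqP at_t da; exists a => // b /eqP; rewrite -mw; exact: da.
  - have [w pw] := puncture_cycle_exists p; have [uw mw] := puncture_cycle_mem pw.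
    have /(sum_binary_eq1 _ uw)[a] := sum1 w (appears_puncture_cycle pw).
    rewrite mw => /eqP at_p da; exists a => // b /eqP; rewrite -mw; exact: da.
  apply: d0 => w /appears_inP[[t int_t tw]|[p pw]].
    have [_ ->] := tri_cycle_mem tw; apply: contra nb => /eqP at_t.
    by rewrite /type_b at_t int_t.
  have [_ ->] := puncture_cycle_mem pw; apply: contra na => /eqP at_p.
  by rewrite /type_a /at_puncture at_p (valP p).
split=> [w /appears_inP[[t int_t tw]|[p pw]]|a not_in].
- have [uw mw] := tri_cycle_mem tw; apply/sum_binary_eq1 => //.
  have [a at_t da] := tri1 t int_t; exists a; first by rewrite mw at_t.
  by move=> b; rewrite mw => /eqP; apply: da.
- have [uw mw] := puncture_cycle_mem pw; apply/sum_binary_eq1 => //.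
  have [a at_p da] := pun1 p; exists a; first by rewrite mw at_p.
  by move=> b; rewrite mw => /eqP; apply: da.
apply: d0; apply/negP => aX.
  pose p : puncture tau := exist _ (point_of (val a)) aX.
  have [w pw] := puncture_cycle_exists p; have [_ mw] := puncture_cycle_mem pw.
  by have := not_in w (appears_puncture_cycle pw); rewrite mw eqxx.
have /andP[int_t _] := aX.
have [w tw] := tri_cycle_exists int_t; have [_ mw] := tri_cycle_mem tw.
by have := not_in w (appears_tri_cycle int_t tw); rewrite mw eqxx.
Qed.

End Potential.

(** * Edges of the graph and their ends *)

Definition arrow_of (e : edge tau) : arrow tau :=
  match e with
  | inl (inl a) => val a
  | inl (inr a) => val a
  | inr a => val a
  end.

Definition is_F (e : edge tau) : bool := if e is inr _ then true else false.

Definition is_typea (e : edge tau) : bool :=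
  if e is inl (inl _) then true else false.

Lemma is_typeaE e : is_typea e = ~~ is_F e && at_puncture (val (arrow_of e)).
Proof. by case: e => [[[a pa]|[a /= /andP[_ /negPf->]]]|a]. Qed.

Lemma internal_not_F e : internal (tri_of (arrow_of e)) -> ~~ is_F e.
Proof.
case: e => [//|[a ca]] /= /forallP int_t.
by have /andP[/existsP[k]] := bd_c ca; rewrite int_t.
Qed.

(** Types (a) and (b) exclude each other, so an arrow carries at most one edge [E_a] and at most one
    edge [F_a]. *)
Lemma edge_inj e f : arrow_of e = arrow_of f -> is_F e = is_F f -> e = f.
Proof.
case: e f => [[[a pa]|[a pa]]|[a pa]] [[[b pb]|[b pb]]|[b pb]] //= eq_ab _;
  subst b; try by congr (inl (inl _)); apply: val_inj.
- by have /andP[_] := pb; rewrite (pa : at_puncture _).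
- by have /andP[_] := pa; rewrite (pb : at_puncture _).
- by congr (inl (inr _)); apply: val_inj.
by congr inr; apply: val_inj.
Qed.

Lemma White_ends v e : (White v \in ends e) = (tri_of (arrow_of e) == val v).
Proof.
by case: e => [[a|a]|a] /=; rewrite !inE //= ?orbF; exact: (eq_sym (val v)).
Qed.

Lemma Black_ends p e :
  (Black p \in ends e) = is_typea e && (point_of (val (arrow_of e)) == val p).
Proof.
by case: e => [[a|a]|a] /=; rewrite !inE //= ?orbF; exact: (eq_sym (val p)).
Qed.

Lemma Grey_ends v e :
  (Grey v \in ends e) = ~~ is_typea e && (tri_of (arrow_of e) == val v).
Proof.
by case: e => [[a|a]|a] /=; rewrite !inE //= ?orbF; exact: (eq_sym (val v)).
Qed.

Lemma white_tri e : is_white (tri_of (arrow_of e)).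
Proof.
by case: e => [[a|a]|a] /=;
  [exact: white_a (valP a)|exact: white_b (valP a)|exact: white_c (valP a)].
Qed.

Lemma E_edge a : type_a a || type_b a ->
  exists2 e, arrow_of e = a & ~~ is_F e.
Proof.
case: (boolP (type_a a)) => [pa _|_ /= pb].
  by exists (inl (inl (exist _ a pa))).
by exists (inl (inr (exist _ a pb))).
Qed.

(** Two distinct angles of a triangle involve all three of its sides, so two arrows force the
    triangle to be internal. *)
Lemma arrow_uniq a b : tri_of a = tri_of b -> ~~ internal (tri_of a) -> a = b.
Proof.
case: a b => [[t i] arr_i] [[u j] arr_j]; rewrite /tri_of /= => eq_tu; subst u.
move=> not_int; apply: val_inj => /=; congr (_, _).
apply: contraNeq not_int => neq_ij; apply/forallP => k.
suff: [|| k == i, k == ordS i, k == j | k == ordS j].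
  by case/andP: arr_i => ? ?; case/andP: arr_j => ? ?; case/or4P=> /eqP->.
by case: i j k neq_ij {arr_i arr_j} => [[|[|[|i]]] lt_i] // [[|[|[|j]]] lt_j] //
  [[|[|[|k]]] lt_k].
Qed.

Lemma type_c_not_internal a :
  at_puncture (val a) -> ~~ internal (tri_of a) -> type_c a.
Proof.
move=> pa not_int; rewrite /type_c pa andbT; apply/cards1P.
exists (val a).2; apply/setP => i; rewrite !inE; apply/idP/eqP => [arr_i|->].
  have <- // : exist _ (tri_of a, i) arr_i = a by apply: arrow_uniq.
by rewrite /tri_of -surjective_pairing (valP a).
Qed.

(** * The two maps between cuts and matchings *)

Definition cut_matching (d : {ffun arrow tau -> 'I_2}) : {set edge tau} :=
  [set e | (d (arrow_of e) != ord0) (+) is_F e].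

Definition matching_cut (M : {set edge tau}) : {ffun arrow tau -> 'I_2} :=
  [ffun a => if [exists e in M, ~~ is_F e && (arrow_of e == a)]
             then ord_max else ord0].

Lemma matching_cutP (M : {set edge tau}) a :
  reflect (exists2 e, e \in M & ~~ is_F e /\ arrow_of e = a)
          (matching_cut M a != ord0).
Proof.
rewrite ffunE; case: ifP => [/exists_inP|/exists_inP] ex; constructor.
  by case: ex => e eM /andP[nF /eqP ea]; exists e.
by case=> e eM [nF ea]; case: ex; exists e; rewrite // nF ea /=.
Qed.

(** Membership of [E_a] reveals the degree of [a]; arrows without such an edge have degree 0 by
    hypothesis. *)
Lemma cut_matching_inj (d d' : {ffun arrow tau -> 'I_2}) :
  (forall a, ~~ type_a a -> ~~ type_b a -> d a = ord0) ->
  (forall a, ~~ type_a a -> ~~ type_b a -> d' a = ord0) ->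
  cut_matching d = cut_matching d' -> d = d'.
Proof.
move=> d0 d0' eqM; apply/ffunP => a.
case: (boolP (type_a a || type_b a)) => [/E_edge[e ea nF]|]; last first.
  by rewrite negb_or => /andP[na nb]; rewrite d0 ?d0'.
have := congr1 (fun M : {set edge tau} => e \in M) eqM.
rewrite !inE ea (negPf nF) !addbF.
by case: (d a) (d' a) => [[|[|k]] lt_k] [[|[|k']] lt_k'] //= _; apply: val_inj.
Qed.

Lemma partial_matching_eq (G : multigraph) (M : {set gedge G}) v e f :
  partial_matching M -> e \in M -> f \in M ->
  v \in gends e -> v \in gends f -> e = f.
Proof.
move=> pm eM fM ve vf; apply/eqP; apply: contraTT ve => /(pm e f eM fM).
by move/disjointFl=> -> //.
Qed.

(** The set [V] can always be chosen as the grey vertices that [M] misses, so only the white and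
    black vertices impose covering conditions. *)
Lemma perfect_off_greyP (M : {set edge tau}) :
  (exists2 V : {set gvertex (graph_of tau)},
     V \subset grey_vertices tau & @perfect_matching_off (graph_of tau) V M) <->
  [/\ @partial_matching (graph_of tau) M,
      forall v : white tau, exists2 e, e \in M & White v \in ends e
    & forall p : black tau, exists2 e, e \in M & Black p \in ends e].
Proof.
split=> [[V sub_V [_ pm cov]]|[pm covW covB]].
  by split=> // v; apply: cov; apply/negP => /(fintype.subsetP sub_V)/imsetP[].
exists [set v in grey_vertices tau | [forall e in M, v \notin ends e]].
  by apply/fintype.subsetP => v; rewrite inE => /andP[].
split=> // [e eM|].
  rewrite disjoint_subset; apply/fintype.subsetP => v ve; rewrite !inE.
  by apply/nandP; right; apply/forall_inPn; exists e; rewrite // negbK.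
move=> [[v|p]|v]; [by move=> _; apply: covW|by move=> _; apply: covB|].
rewrite inE (imset_f (@Grey tau)) //= => /forall_inPn[e eM].
by rewrite negbK; exists e.
Qed.

Lemma cut_matching_perfect (d : {ffun arrow tau -> 'I_2}) :
  (forall t, internal t -> exists2 a, tri_of a = t &
     forall b, tri_of b = t -> (d b != ord0) = (b == a)) ->
  (forall p : puncture tau, exists2 a, point_of (val a) = val p &
     forall b, point_of (val b) = val p -> (d b != ord0) = (b == a)) ->
  [/\ @partial_matching (graph_of tau) (cut_matching d),
      forall v : white tau, exists2 e, e \in cut_matching d & White v \in ends e
    & forall p : black tau, exists2 e, e \in cut_matching d & Black p \in ends e].
Proof.
move=> tri1 pun1.
(* At most one edge is selected per triangle; this settles conflicts at white and at grey vertices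
   alike. *)
have tri_eq e f : e \in cut_matching d -> f \in cut_matching d ->
    tri_of (arrow_of e) = tri_of (arrow_of f) -> e = f.
  rewrite !inE => eM fM eq_t.
  have [int_t|nint] := boolP (internal (tri_of (arrow_of e))).
    have int_f : internal (tri_of (arrow_of f)) by rewrite -eq_t.
    have [a _ da] := tri1 _ int_t.
    move: eM fM; rewrite !(negPf (internal_not_F _)) // !addbF !da //.
    move=> /eqP ea /eqP fa; apply: edge_inj; first by rewrite ea fa.
    by rewrite !(negPf (internal_not_F _)).
  (* A non-internal triangle has one arrow, and its [E_a] and [F_a] are selected under opposite
     conditions. *)
  have eq_a := arrow_uniq eq_t nint; apply: edge_inj => //.
  by move: eM fM; rewrite eq_a; case: (d _ == _) (is_F e) (is_F f) => [] [] [].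
split.
- move=> e f eM fM; apply: contraNT => /pred0Pn[v /andP[/= ve vf]]; apply/eqP.
  case: v ve vf => [[v|p]|v].
  + by rewrite !White_ends => /eqP te /eqP tf; apply: tri_eq; rewrite // te tf.
  + rewrite !Black_ends !is_typeaE => /andP[/andP[nFe _] /eqP pe].
    case/andP=> /andP[nFf _] /eqP pf; have [a _ da] := pun1 p.
    apply: edge_inj; last by rewrite (negPf nFe) (negPf nFf).
    move: eM fM; rewrite !inE (negPf nFe) (negPf nFf) !addbF !da //.
    by move=> /eqP-> /eqP->.
  rewrite !Grey_ends => /andP[_ /eqP te] /andP[_ /eqP tf].
  by apply: tri_eq; rewrite // te tf.
(* The white vertex is covered by [E_a] for the arrow of degree 1 if [t] is internal, and otherwise
   by [E_a] or [F_a] of the single arrow, according to its degree. *)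
- move=> [t /= wt]; case: (boolP (internal t)) => [int_t|nint].
    have [a at_t da] := tri1 t int_t.
    have [|e ea nF] := @E_edge a.
      by rewrite /type_b at_t int_t /= /type_a orbN.
    by exists e; rewrite ?White_ends /= ?ea ?at_t // inE (negPf nF) addbF ea da /=.
  have /andP[_ /existsP[i pi]] : bd_punctured t.
    by move: wt; rewrite /is_white (negPf nint).
  pose a : arrow tau := exist _ (t, i) (at_puncture_arrow pi).
  have [da|da] := boolP (d a != ord0).
    exists (inl (inl (exist _ a pi))); last by rewrite White_ends.
    by rewrite inE /= addbF.
  exists (inr (exist _ a (type_c_not_internal (a := a) pi nint))).
    by rewrite inE /= addbT.
  by rewrite White_ends.
move=> p; have [a at_p da] := pun1 p.
have pa : type_a a by rewrite /type_a /at_puncture at_p (valP p).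
exists (inl (inl (exist _ a pa))); last by rewrite Black_ends /= at_p.
by rewrite inE /= addbF da.
Qed.

(** * From matchings back to cuts *)

Section PerfectMatching.
Variable M : {set edge tau}.
Hypothesis pmM : @partial_matching (graph_of tau) M.
Hypothesis coverW : forall v : white tau, exists2 e, e \in M & White v \in ends e.
Hypothesis coverB : forall p : black tau, exists2 e, e \in M & Black p \in ends e.

(** Every edge, of whatever type, ends at the white vertex of its triangle. *)
Lemma matching_tri_eq e f : e \in M -> f \in M ->
  tri_of (arrow_of e) = tri_of (arrow_of f) -> e = f.
Proof.
move=> eM fM eq_t; pose v : white tau := exist _ (tri_of (arrow_of e)) (white_tri e).
by apply: (partial_matching_eq (v := White v : gvertex (graph_of tau)) pmM);
  rewrite //= White_ends /= ?eq_t.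
Qed.

Lemma matching_cut_tri t : internal t -> exists2 a, tri_of a = t &
  forall b, tri_of b = t -> (matching_cut M b != ord0) = (b == a).
Proof.
move=> int_t; have wt : is_white t by rewrite /is_white int_t.
have [e eM] := coverW (exist _ t wt); rewrite White_ends => /eqP /= te.
exists (arrow_of e) => // b bt; apply/matching_cutP/eqP => [[f fM [_ fb]]|->].
  by rewrite -fb; congr arrow_of; apply: matching_tri_eq; rewrite // te fb.
by exists e => //; split=> //; apply: internal_not_F; rewrite te.
Qed.

Lemma matching_cut_puncture (p : puncture tau) :
  exists2 a, point_of (val a) = val p &
  forall b, point_of (val b) = val p -> (matching_cut M b != ord0) = (b == a).
Proof.
have [e eM pe] := coverB p; have := pe; rewrite Black_ends is_typeaE.
case/andP=> /andP[nFe _] /eqP ep; exists (arrow_of e) => // b bp.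
apply/matching_cutP/eqP => [[f fM [nFf fb]]|->]; last by exists e.
rewrite -fb; congr arrow_of.
apply: (partial_matching_eq (v := Black p : gvertex (graph_of tau)) pmM) => //=.
by rewrite Black_ends is_typeaE nFf fb bp /at_puncture bp (valP p) eqxx.
Qed.

Lemma matching_cut_eq0 a :
  ~~ type_a a -> ~~ type_b a -> matching_cut M a = ord0.
Proof.
move=> na nb; apply/eqP; apply: contraT => /matching_cutP[e _ []].
case: e => [[[b pb]|[b pb]]|//] _ /= ab.
  by rewrite -ab pb in na.
by rewrite -ab pb in nb.
Qed.

Lemma matching_cutK : cut_matching (matching_cut M) = M.
Proof.
apply/setP => e; rewrite inE; case: (boolP (is_F e)) => [Fe|nFe].
  rewrite addbT negbK; apply/eqP/idP => [d0|eM].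
    (* The edge [f] of [M] covering this white vertex has the same arrow as [e]. It is not [E_a],
       since the degree is 0, so it is [e] itself. *)
    have [f fM] := coverW (exist _ (tri_of (arrow_of e)) (white_tri e)).
    rewrite White_ends => /eqP /= ft.
    have nint : ~~ internal (tri_of (arrow_of f)).
      by rewrite ft; apply: contraL Fe => /internal_not_F.
    have fe := arrow_uniq ft nint.
    have [Ff|nFf] := boolP (is_F f); first by rewrite -(edge_inj fe) // Fe.
    have /matching_cutP : exists2 f, f \in M & ~~ is_F f /\ arrow_of f = arrow_of e.
      by exists f.
    by rewrite d0 eqxx.
  (* Conversely, [E_a] and [F_a] cannot both lie in [M], as they share their white vertex. *)
  apply/eqP; apply: contraT => /matching_cutP[f fM [nFf fe]].
  by rewrite (matching_tri_eq fM eM) ?fe ?Fe in nFf.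
rewrite addbF; apply/matching_cutP/idP => [[f fM [nFf fe]]|eM]; last by exists e.
by rewrite -(edge_inj fe) // (negPf nFf) (negPf nFe).
Qed.

End PerfectMatching.

End Triangulation.

Theorem lemma6p3 (R : realType) (tau : triangulation)
    (tau_surface : ~~ excluded_surface tau)
    (tau_boundary : has_boundary tau)
    (tau_valency : valency_ge3 tau)
    (x : puncture tau -> R[i])
    (x_neq0 : forall p, x p != 0) :
  exists f : {ffun qarrow (quiver_of tau) -> 'I_2} -> {set gedge (graph_of tau)},
    set_bij
      (fun d => admissible_cut (potential_of x) d)
      (fun M => partial_matching M /\
         exists2 V : {set gvertex (graph_of tau)},
           V \subset grey_vertices tau & perfect_matching_off V M)
      f.
Proof.
exists (@cut_matching tau); split.
- move=> d /(admissible_cutP x_neq0)[tri1 pun1 _].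
  have perf := cut_matching_perfect tri1 pun1.
  by split; [case: perf|apply/perfect_off_greyP].
- move=> d d'; rewrite !inE.
  move=> /(admissible_cutP x_neq0)[_ _ d0] /(admissible_cutP x_neq0)[_ _ d0'].
  exact: cut_matching_inj.
move=> M [_ /perfect_off_greyP[pm covW covB]].
exists (matching_cut M); last exact: matching_cutK.
apply/(admissible_cutP x_neq0); split.
- exact: matching_cut_tri.
- exact: matching_cut_puncture.
exact: matching_cut_eq0.
Qed.
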